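(* For every graph $G$, $b(G)-1\le b_L(G)\le b(G)+1$.
   Context: For a finite simple graph $H$, a burning sequence is a sequence $(b_1,\dots,b_t)$ of vertices such that every vertex $v$ satisfies $d_H(v,b_i)\le t-i$ for some $i\in\{1,\dots,t\}$; $b(H)$ is the minimum length of a burning sequence. The line graph $L(G)$ has vertex set $E(G)$, two vertices adjacent iff the edges share an endpoint. The edge burning number of $G$ is $b_L(G)=b(L(G))$.
   Formalization: The lower bound b(G)-1 ≤ b_L(G) is stated only for graphs G with at most one isolated vertex (it fails for K2 plus two isolated vertices, where b(G)=3 and b_L(G)=1); the upper bound holds for every finite simple graph. *)

(* Defs.v *)
From HB Require Import structures.
From mathcomp Require Import all_boot.

Set Implicit Arguments.
Unset Strict Implicit.
Unset Printing Implicit Defensive.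

Record sgraph := SGraph {
  vertex :> finType;
  adj : rel vertex;
  adj_sym : symmetric adj;
  adj_irrefl : irreflexive adj
}.

Definition walk (G : sgraph) (k : nat) (x y : G) : bool :=
  [exists p : k.-tuple G, path (@adj G) x p && (last x p == y)].

Lemma connect_walk (G : sgraph) (x y : G) :
  connect (@adj G) x y -> exists k, walk k x y.
Proof.
case/connectP=> p xp ->; exists (size p).
by apply/existsP; exists (in_tuple p); rewrite xp eqxx.
Qed.

(* None stands for an infinite distance (distinct components). *)
Definition dist (G : sgraph) (x y : G) : option nat :=
  if @idP (connect (@adj G) x y) is ReflectT xy
  then Some (ex_minn (connect_walk xy)) else None.

Definition odist_le (d : option nat) (k : nat) : bool :=
  if d is Some m then m <= k else false.

(* Indices start at 0 here: b_(i+1) is tnth b i, with radius t - (i+1). *)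
Definition burning (G : sgraph) (t : nat) (b : t.-tuple G) : bool :=
  [forall v : G, exists i : 'I_t, odist_le (dist v (tnth b i)) (t - i.+1)].

Lemma dist_refl (G : sgraph) (x : G) : dist x x = Some 0.
Proof.
rewrite /dist; case: {-}_ / idP => [xx|]; last by rewrite connect0.
case: ex_minnP => m _ /(_ 0) min_m; congr Some; apply/eqP.
rewrite -leqn0; apply: min_m.
by apply/existsP; exists [tuple]; rewrite /= eqxx.
Qed.

Lemma burning_exists (G : sgraph) :
  exists t, [exists b : t.-tuple G, burning b].
Proof.
exists #|G|; apply/existsP; exists (enum_tuple G); apply/forallP => v.
apply/existsP; exists (enum_rank v).
have -> : tnth (enum_tuple G) (enum_rank v) = v.
  by rewrite (tnth_nth v) /=; exact: nth_enum_rank.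
by rewrite dist_refl.
Qed.

Definition burning_number (G : sgraph) : nat := ex_minn (burning_exists G).

Definition edges (G : sgraph) : {set {set G}} :=
  [set [set p.1; p.2] | p : G * G & adj p.1 p.2].

Definition line_vertex (G : sgraph) : finType := {e : {set G} | e \in edges G}.

Definition line_adj (G : sgraph) : rel (line_vertex G) :=
  fun e f => (e != f) && (val e :&: val f != set0).

Lemma line_adj_sym (G : sgraph) : symmetric (@line_adj G).
Proof. by move=> e f; rewrite /line_adj eq_sym setIC. Qed.

Lemma line_adj_irrefl (G : sgraph) : irreflexive (@line_adj G).
Proof. by move=> e; rewrite /line_adj eqxx. Qed.

Definition line_graph (G : sgraph) : sgraph :=
  SGraph (@line_adj_sym G) (@line_adj_irrefl G).

Definition edge_burning_number (G : sgraph) : nat :=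
  burning_number (line_graph G).

(* Isolated vertices are invisible to the line graph: for K2 plus two isolated
   vertices, b(G) = 3 but b(L(G)) = 1, so b(G) - 1 <= b(L(G)) needs a bound on
   their number. Connected graphs have at most one. *)
Definition isolated (G : sgraph) : {set G} :=
  [set x : G | [forall y : G, ~~ adj x y]].

(* Main.v *)
Require Import Defs.
From mathcomp Require Import all_boot.

Set Implicit Arguments.
Unset Strict Implicit.
Unset Printing Implicit Defensive.

(** Replacing each edge of a burning sequence of L(G) by one of its endpoints, or
    each vertex of a burning sequence of G by an incident edge, increases the
    relevant distances by at most 1. One additional step makes up for it; its own
    source, of radius 0, takes care of the isolated vertex if there is one. *)

(** Any walk of length at most [k] certifies the bound, so later arguments build walks and never
    deal with minimality or infinite distances. *)
Lemma odist_leP (G : sgraph) (x y : G) (k : nat) :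
  reflect (exists p, [/\ path (@adj G) x p, last x p = y & size p <= k])
          (odist_le (dist x y) k).
Proof.
apply: (iffP idP) => [|[p [xp ly pk]]]; rewrite /dist.
  case: {-}_ / idP => // xy /=; case: ex_minnP => m /existsP[p].
  by case/andP=> xp /eqP ly _ mk; exists p; rewrite size_tuple.
case: {-}_ / idP => [xy|[]] /=; last by apply/connectP; exists p.
case: ex_minnP => m _ /(_ (size p)) min_m; apply: leq_trans pk; apply: min_m.
by apply/existsP; exists (in_tuple p); rewrite xp ly eqxx.
Qed.

Lemma odist_le_refl (G : sgraph) (x : G) (k : nat) : odist_le (dist x x) k.
Proof. by rewrite dist_refl. Qed.

Lemma odist_le_adj (G : sgraph) (x y : G) : adj x y -> odist_le (dist x y) 1.
Proof. by move=> xy; apply/odist_leP; exists [:: y]; rewrite /= xy. Qed.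

Lemma odist_le_widen (G : sgraph) (x y : G) (m n : nat) :
  m <= n -> odist_le (dist x y) m -> odist_le (dist x y) n.
Proof. by move=> mn; case: dist => //= d /leq_trans; apply. Qed.

Lemma odist_le_trans (G : sgraph) (y x z : G) (m n : nat) :
  odist_le (dist x y) m -> odist_le (dist y z) n -> odist_le (dist x z) (m + n).
Proof.
move=> /odist_leP[p [xp <- pm]] /odist_leP[q [yq <- qn]].
by apply/odist_leP; exists (p ++ q); rewrite cat_path xp last_cat size_cat leq_add.
Qed.

Lemma burning_number_min (G : sgraph) (t : nat) (b : t.-tuple G) :
  burning b -> burning_number G <= t.
Proof.
move=> bG; rewrite /burning_number; case: ex_minnP => m _; apply.
by apply/existsP; exists b.
Qed.

(** Covers the targets that have no vertex to serve as [h0] in the transfer below. *)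
Lemma burning_number0 (G : sgraph) : (G -> False) -> burning_number G = 0.
Proof.
move=> G0; apply/eqP; rewrite -leqn0; apply: (@burning_number_min G 0 [tuple]).
by apply/forallP => v; case: (G0 v).
Qed.

Lemma burning_number_transfer (G H : sgraph) (f : G -> H) (h0 : H) :
    (forall v : H, v = h0 \/ exists u : G, forall (w : G) (k : nat),
       odist_le (dist u w) k -> odist_le (dist v (f w)) k.+1) ->
  burning_number H <= (burning_number G).+1.
Proof.
move=> fP; rewrite {2}/burning_number; case: ex_minnP => t /existsP[b /forallP bG] _.
apply: (@burning_number_min H t.+1 [tuple of rcons (map f b) h0]); apply/forallP => v.
have [->|[u uP]] := fP v.
  (* The appended source has index [t], hence radius [t.+1 - t.+1 = 0]. *)
  apply/existsP; exists ord_max.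
  by rewrite (tnth_nth h0) /= nth_rcons size_map size_tuple ltnn eqxx odist_le_refl.
(* The source keeps its index while the length grows by one, so its radius gains exactly the 1 lost
   by [f]. *)
have /existsP[i ui] := bG u; apply/existsP; exists (widen_ord (leqnSn t) i).
rewrite (tnth_nth h0) /= nth_rcons size_map size_tuple ltn_ord.
rewrite (nth_map (tnth b i)) ?size_tuple // -tnth_nth subSn //.
exact: uP.
Qed.

Lemma mem_edges (G : sgraph) (x y : G) : adj x y -> [set x; y] \in edges G.
Proof. by move=> xy; apply/imsetP; exists (x, y); rewrite ?inE. Qed.

Lemma line_vertex_ends (G : sgraph) (e : line_vertex G) :
  exists x y : G, adj x y /\ val e = [set x; y].
Proof.
case/imsetP: (valP e) => -[x y]; rewrite inE /= => xy ee.
by exists x, y.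
Qed.

Lemma line_vertex_edge (G : sgraph) (x y : G) :
  adj x y -> exists e : line_vertex G, x \in val e /\ y \in val e.
Proof.
move=> xy; exists (Sub [set x; y] (mem_edges xy)).
by rewrite SubK !inE !eqxx orbT.
Qed.

Lemma odist_le_edge (G : sgraph) (e : line_vertex G) (x y : G) :
  x \in val e -> y \in val e -> odist_le (dist x y) 1.
Proof.
have [u [v [uv ->]]] := line_vertex_ends e.
rewrite !inE => /orP[]/eqP-> /orP[]/eqP->; rewrite ?odist_le_refl //.
  exact: odist_le_adj.
by apply: odist_le_adj; rewrite adj_sym.
Qed.

Lemma odist_le_line (G : sgraph) (e f : line_graph G) (x : G) :
  x \in val e -> x \in val f -> odist_le (dist e f) 1.
Proof.
move=> xe xf; have [->|ef] := eqVneq e f; first exact: odist_le_refl.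
apply: odist_le_adj; rewrite /adj /= /line_adj ef /=.
by apply/set0Pn; exists x; rewrite inE xe.
Qed.

(** Consecutive edges of a walk of length m from [e] to [f] share vertices z_1, ..., z_m. In the
    sequence x, z_1, ..., z_m, y neighbouring terms lie on a common edge, which gives m + 1 steps of
    length at most 1. *)
Lemma odist_le_of_line (G : sgraph) (e f : line_graph G) (x y : G) (k : nat) :
    odist_le (dist e f) k -> x \in val e -> y \in val f ->
  odist_le (dist x y) k.+1.
Proof.
case/odist_leP=> p [ep <- pk] xe yf; apply: (@odist_le_widen _ _ _ (size p).+1) => //.
elim: p e x ep xe yf {pk} => [|g p IHp] e x /=; first by move=> _; apply: odist_le_edge.
case/andP=> /andP[_ /set0Pn[z /setIP[ze zg]]] gp xe yf.
rewrite -add1n; apply: (@odist_le_trans _ z).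
  exact: odist_le_edge xe ze.
exact: IHp gp zg yf.
Qed.

(** Dually, put [e] before and [f] after the m edges of a walk from [x] to [y]: of these m + 2 edges
    neighbouring ones share a vertex, so there are m + 1 steps of length at most 1. *)
Lemma odist_le_to_line (G : sgraph) (e f : line_graph G) (x y : G) (k : nat) :
    odist_le (dist x y) k -> x \in val e -> y \in val f ->
  odist_le (dist e f) k.+1.
Proof.
case/odist_leP=> p [xp <- pk] xe yf; apply: (@odist_le_widen _ _ _ (size p).+1) => //.
elim: p e x xp xe yf {pk} => [|z p IHp] e x /=; first by move=> _; apply: odist_le_line.
case/andP=> /line_vertex_edge[g [xg zg]] zp xe yf.
rewrite -add1n; apply: (@odist_le_trans (line_graph G) g).
  exact: odist_le_line xe xg.
exact: IHp zp zg yf.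
Qed.

Lemma burning_number_le_edge (G : sgraph) :
  #|isolated G| <= 1 -> burning_number G <= (edge_burning_number G).+1.
Proof.
move=> /card_le1P iso1; case: (pickP (mem G)) => [x0 _|G0]; last first.
  by rewrite burning_number0 // => v; have := G0 v.
pose f (e : line_graph G) : G := odflt x0 [pick x in val e].
have fE (e : line_graph G) : f e \in val e.
  rewrite /f; case: pickP => //= e0; have [x [y [_ ee]]] := line_vertex_ends e.
  by have := e0 x; rewrite ee !inE eqxx.
(* With no isolated vertex, the default [x0] merely fills the last place. *)
pose h0 := odflt x0 [pick x in isolated G].
apply: (@burning_number_transfer (line_graph G) G f h0) => v.
case vi: (v \in isolated G).
  left; rewrite /h0; case: pickP => [w wi /=|/(_ v)]; last by rewrite vi.
  by have := iso1 _ wi v; rewrite vi inE => /esym/eqP.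
right; move: vi; rewrite inE => /negbT/forallPn[y /negPn /line_vertex_edge[e [ve _]]].
by exists e => w k ew; apply: odist_le_of_line ew ve (fE w).
Qed.

Lemma edge_burning_number_le (G : sgraph) :
  edge_burning_number G <= (burning_number G).+1.
Proof.
case: (pickP (mem (line_graph G))) => [e0 _|E0]; last first.
  by rewrite /edge_burning_number burning_number0 // => e; have := E0 e.
(* The default [e0] is taken exactly at isolated vertices, where no incident edge exists. *)
pose f (x : G) : line_graph G := odflt e0 [pick e : line_vertex G | x \in val e].
have fE (x : G) (e : line_vertex G) : x \in val e -> x \in val (f x).
  by rewrite /f; case: pickP => //= /(_ e) ->.
apply: (@burning_number_transfer G (line_graph G) f e0) => e; right.
have [x [y [xy ee]]] := line_vertex_ends e.
have xe : x \in val e by rewrite ee !inE eqxx.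
(* It remains to see that [f w] is incident to [w], that is, that [w] lies on some edge. As [w] is
   reachable from [x], either it equals [x], which lies on [e], or it ends the last edge of the
   walk. *)
exists x => w k xw; apply: odist_le_to_line (xw) (xe) _.
case/odist_leP: xw => p [xp <- _]; case/lastP: p xp => [|p z] /=.
  by move=> _; apply: fE xe.
rewrite rcons_path last_rcons => /andP[_ /line_vertex_edge[g [_ zg]]].
exact: fE zg.
Qed.

Theorem theorem5 (G : sgraph) :
  (#|isolated G| <= 1 -> burning_number G - 1 <= edge_burning_number G) /\
  edge_burning_number G <= burning_number G + 1.
Proof.
rewrite leq_subLR add1n addn1.
by split; [apply: burning_number_le_edge | apply: edge_burning_number_le].
Qed.
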